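(* For every integer $k \ge 1$, let $G_k$ be the cubic graph on $n = 8k$ vertices formed from $k$ disjoint copies $H_1,\dots,H_k$ of the graph $H$ (defined in the context) by adding the edges $h_i g_{i+1}$ for $i = 1,\dots,k$, with indices taken modulo $k$ (so $g_{k+1} = g_1$), where $g_i, h_i$ are the copies of the vertices $g,h$ in $H_i$. Then $\textrm{DET:IC\%}(G_k) = \frac{7}{8}$.
   Context: $H$ is the graph on the 8 vertices $a,b,c,d,e,f,g,h$ with the 11 edges $ga, ge, ca, ce, cd, db, df, hb, hf, ab, ef$ (equivalently, the 3-dimensional cube graph with the edge $gh$ removed); $g$ and $h$ have degree 2 in $H$ and all other vertices have degree 3. For a vertex $v$ of a graph $G$, $N[v]$ is its closed neighborhood, and for $S \subseteq V(G)$, $N_S[v] = N[v]\cap S$. A set $S \subseteq V(G)$ is an error-detecting identifying code (DET:IC) of $G$ if $|N_S[v]| \ge 2$ for every $v \in V(G)$, and for all distinct $u,v \in V(G)$, $|N_S[u] - N_S[v]| \ge 2$ or $|N_S[v] - N_S[u]| \ge 2$. For a finite graph $G$, $\textrm{DET:IC\%}(G)$ is the minimum of $|S|/|V(G)|$ over all DET:ICs $S$ of $G$. *)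

(* Defs.v *)
From HB Require Import structures.
From mathcomp Require Import all_boot all_order all_algebra.
Set Implicit Arguments.
Unset Strict Implicit.
Unset Printing Implicit Defensive.
Import Order.TTheory GRing.Theory Num.Theory.

Record sgraph := SGraph {
  vertex :> finType;
  adj : rel vertex;
  adj_sym : symmetric adj;
  adj_irr : irreflexive adj }.

Definition neighborhood (G : sgraph) (v : G) : {set G} := [set w | adj v w].

Definition closed_neighborhood (G : sgraph) (v : G) : {set G} :=
  v |: neighborhood v.

Definition closed_neighborhood_in (G : sgraph) (S : {set G}) (v : G) : {set G} :=
  closed_neighborhood v :&: S.

Definition cubic (G : sgraph) : Prop := forall v : G, #|neighborhood v| = 3.

Definition is_DETIC (G : sgraph) (S : {set G}) : Prop :=
  (forall v : G, 2 <= #|closed_neighborhood_in S v|) /\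
  (forall u v : G, u <> v ->
     2 <= #|closed_neighborhood_in S u :\: closed_neighborhood_in S v| \/
     2 <= #|closed_neighborhood_in S v :\: closed_neighborhood_in S u|).

Definition density (G : sgraph) (S : {set G}) : rat :=
  (#|S|%:R / #|G|%:R)%R.

(* The minimum is stated as a relation because a graph may have no DET:IC at
   all, in which case DET:IC%(G) is undefined and this holds for no [r]. *)
Definition DETIC_pct (G : sgraph) (r : rat) : Prop :=
  (exists2 S : {set G}, is_DETIC S & density S = r) /\
  (forall S : {set G}, is_DETIC S -> (r <= density S)%R).

Inductive Hvertex := va | vb | vc | vd | ve | vf | vg | vh.

Definition Hvertex_to_ord (x : Hvertex) : 'I_8 :=
  match x with
  | va => @Ordinal 8 0 isT | vb => @Ordinal 8 1 isT
  | vc => @Ordinal 8 2 isT | vd => @Ordinal 8 3 isT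
  | ve => @Ordinal 8 4 isT | vf => @Ordinal 8 5 isT
  | vg => @Ordinal 8 6 isT | vh => @Ordinal 8 7 isT
  end.

Definition Hvertex_of_ord (i : 'I_8) : Hvertex :=
  nth va [:: va; vb; vc; vd; ve; vf; vg; vh] i.

Lemma Hvertex_to_ordK : cancel Hvertex_to_ord Hvertex_of_ord.
Proof. by case. Qed.

HB.instance Definition _ := Countable.copy Hvertex (can_type Hvertex_to_ordK).
HB.instance Definition _ : isFinite Hvertex := CanIsFinite Hvertex_to_ordK.

Lemma Hvertex_eqE (x y : Hvertex) :
  (x == y) = match x, y with
             | va, va | vb, vb | vc, vc | vd, vd
             | ve, ve | vf, vf | vg, vg | vh, vh => true
             | _, _ => false
             end.
Proof. by apply/eqP/idP => [->|]; [case: y | case: x; case: y]. Qed.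

Lemma card_Hvertex : #|{: Hvertex}| = 8.
Proof.
rewrite -[RHS](card_ord 8); apply: (bij_eq_card (f := Hvertex_to_ord)).
exists Hvertex_of_ord; first exact: Hvertex_to_ordK.
by case=> m lt_m; apply: val_inj; do 8?[case: m lt_m => [|m] lt_m //].
Qed.

Definition H_edges : seq (Hvertex * Hvertex) :=
  [:: (vg, va); (vg, ve); (vc, va); (vc, ve); (vc, vd); (vd, vb);
      (vd, vf); (vh, vb); (vh, vf); (va, vb); (ve, vf)].

Definition H_adj : rel Hvertex :=
  fun x y => ((x, y) \in H_edges) || ((y, x) \in H_edges).

(* [ordS] is the cyclic successor on ['I_k], so the last copy is linked back to
   the first; for [k = 1] the single link is the edge [gh]. *)
Definition Gk_link (k : nat) : rel ('I_k * Hvertex) :=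
  fun u v => [&& u.2 == vh, v.2 == vg & v.1 == ordS u.1].

Definition Gk_adj (k : nat) : rel ('I_k * Hvertex) :=
  fun u v => [|| (u.1 == v.1) && H_adj u.2 v.2, Gk_link u v | Gk_link v u].

Lemma Gk_adj_sym (k : nat) : symmetric (@Gk_adj k).
Proof.
move=> u v; rewrite /Gk_adj /H_adj eq_sym; congr (_ || _); last exact: orbC.
by congr (_ && _); exact: orbC.
Qed.

Lemma Gk_adj_irr (k : nat) : irreflexive (@Gk_adj k).
Proof.
case=> i x; rewrite /Gk_adj /Gk_link /H_adj /= eqxx.
by case: x; rewrite !inE !xpair_eqE !Hvertex_eqE.
Qed.

Definition Gk (k : nat) : sgraph := SGraph (@Gk_adj_sym k) (@Gk_adj_irr k).

Lemma card_Gk (k : nat) : #|Gk k| = 8 * k.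
Proof. by rewrite card_prod card_ord card_Hvertex mulnC. Qed.

Local Ltac solveH :=
  rewrite ?inE ?Hvertex_eqE //=;
  by case; rewrite /H_adj !inE !xpair_eqE !Hvertex_eqE.

Lemma Gk_cubic (k : nat) : cubic (Gk k).
Proof.
have nbE (v x y z : 'I_k * Hvertex) : uniq [:: x; y; z] ->
    (forall w, Gk_adj v w = (w \in [:: x; y; z])) ->
    #|neighborhood (v : Gk k)| = 3.
  move=> Uxyz vE; rewrite (eq_card (B := mem [:: x; y; z])).
    by move/card_uniqP: Uxyz => ->.
  by move=> w; rewrite inE; exact: vE.
have inH (v x y z : Hvertex) i : v != vg -> v != vh -> uniq [:: x; y; z] ->
    (forall w, H_adj v w = (w \in [:: x; y; z])) ->
    #|neighborhood ((i, v) : Gk k)| = 3.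
  move=> vg' vh' Uxyz vE; apply: (nbE _ (i, x) (i, y) (i, z)).
    by move: Uxyz; rewrite /= !inE !xpair_eqE !eqxx.
  case=> j w; rewrite /Gk_adj /Gk_link /= (negPf vg') (negPf vh') /= andbF orbF.
  rewrite vE !inE !xpair_eqE [i == j]eq_sym; case: (j == i) => //=.
case=> i x; case: x.
- by apply: (inH va vg vc vb); solveH.
- by apply: (inH vb vd vh va); solveH.
- by apply: (inH vc va ve vd); solveH.
- by apply: (inH vd vc vb vf); solveH.
- by apply: (inH ve vg vc vf); solveH.
- by apply: (inH vf vd vh ve); solveH.
- apply: (nbE _ (i, va) (i, ve) (ord_pred i, vh)).
    by rewrite /= !inE !xpair_eqE !Hvertex_eqE !andbF.
  case=> j w; rewrite /Gk_adj /Gk_link /H_adj /= !inE !xpair_eqE !Hvertex_eqE.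
  have -> : (i == ordS j) = (j == ord_pred i).
    by apply/eqP/eqP => ->; rewrite ?ordSK ?ord_predK.
  by rewrite [i == j]eq_sym; case: w; rewrite /= ?Hvertex_eqE /= ?andbT ?andbF ?orbF.
- apply: (nbE _ (i, vb) (i, vf) (ordS i, vg)).
    by rewrite /= !inE !xpair_eqE !Hvertex_eqE !andbF.
  case=> j w; rewrite /Gk_adj /Gk_link /H_adj /= !inE !xpair_eqE !Hvertex_eqE.
  by rewrite [i == j]eq_sym; case: w; rewrite /= ?Hvertex_eqE /= ?andbT ?andbF ?orbF.
Qed.

(* Main.v *)
Require Import Defs.
From mathcomp Require Import all_boot all_order all_algebra.
Set Implicit Arguments.
Unset Strict Implicit.
Unset Printing Implicit Defensive.
Import Order.TTheory GRing.Theory Num.Theory.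

(** If two vertices [u], [v] of a cubic graph have two common closed neighbors,
    then [N[u] - N[v]] and [N[v] - N[u]] have at most two elements each, so a
    DET:IC contains one of these differences entirely.  Any two vertices [x],
    [y] of a copy of [H] are separated in this way by some [u], [v] of the same
    copy ([x] in [N[u] - N[v]], [y] in [N[v] - N[u]]), so a DET:IC omits at most
    one vertex of each copy.  Conversely the code omitting exactly the [g_i] is
    a DET:IC. *)

Lemma in_closed_neighborhood (G : sgraph) (u v : G) :
  (v \in closed_neighborhood u) = (v == u) || adj u v.
Proof. by rewrite !inE. Qed.

Lemma card_closed_neighborhood (G : sgraph) (v : G) :
  cubic G -> #|closed_neighborhood v| = 4.
Proof. by move=> cubG; rewrite cardsU1 cubG inE adj_irr. Qed.

Lemma card_set_ge2 (T : finType) (A : {set T}) (x y : T) :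
  x != y -> x \in A -> y \in A -> 2 <= #|A|.
Proof.
move=> neq_xy xA yA; have <- : #|[set x; y]| = 2 by rewrite cards2 neq_xy.
by apply: subset_leq_card; apply/subsetP => z /set2P[] ->.
Qed.

(** Closed neighborhoods have four elements, so two common ones leave at most two in the difference;
    the omitted [x] is one of these. *)
Lemma card_code_diff_lt2 (G : sgraph) (S : {set G}) (u v x : G) :
    cubic G -> 2 <= #|closed_neighborhood u :&: closed_neighborhood v| ->
    x \in closed_neighborhood u :\: closed_neighborhood v -> x \notin S ->
  #|closed_neighborhood_in S u :\: closed_neighborhood_in S v| < 2.
Proof.
move=> cubG common_uv xuv xS.
have le2 : #|closed_neighborhood u :\: closed_neighborhood v| <= 2.
  by rewrite cardsD card_closed_neighborhood // leq_subLR (leq_add2r 2 2).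
apply: leq_trans le2; rewrite [X in _ < X](cardsD1 x) xuv ltnS subset_leq_card //.
apply/subsetP => z /setDP[/setIP[zu zS]]; rewrite in_setI zS andbT => zv.
by rewrite in_setD1 in_setD zv zu !andbT; apply: contraNneq xS => <-.
Qed.

Lemma DETIC_separation (G : sgraph) (S : {set G}) (u v x y : G) :
    cubic G -> is_DETIC S ->
    2 <= #|closed_neighborhood u :&: closed_neighborhood v| ->
    x \in closed_neighborhood u :\: closed_neighborhood v ->
    y \in closed_neighborhood v :\: closed_neighborhood u ->
  (x \in S) || (y \in S).
Proof.
move=> cubG [_ sepS] common_uv xuv yvu.
apply/norP; case=> xS yS.
have neq_uv : u <> v by move=> eq_uv; rewrite eq_uv setDv inE in xuv.
have := card_code_diff_lt2 cubG common_uv xuv xS.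
rewrite setIC in common_uv; have := card_code_diff_lt2 cubG common_uv yvu yS.
by case: (sepS u v neq_uv); rewrite leqNgt => /negPf ->.
Qed.

(** An explicit list, so that quantifiers over [Hvertex] become boolean searches settled by
    computation. *)
Definition H_enum : seq Hvertex := [:: va; vb; vc; vd; ve; vf; vg; vh].

Lemma mem_H_enum x : x \in H_enum.
Proof. by case: x; rewrite !inE !Hvertex_eqE. Qed.

(** Lower bound, with [cube_near] as upper bound, for the closed neighborhood of a vertex within its
    own copy; the two bounds together treat all [k] uniformly. *)
Definition H_near (u x : Hvertex) : bool := (x == u) || H_adj u x.

(* The edge [gh] is present inside a copy exactly when [k = 1]. *)
Definition cube_near (u x : Hvertex) : bool :=
  [|| H_near u x, (u == vg) && (x == vh) | (u == vh) && (x == vg)].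

Lemma H_near_Gk k (i : 'I_k) u x :
  H_near u x -> ((i, x) : Gk k) \in closed_neighborhood ((i, u) : Gk k).
Proof.
rewrite in_closed_neighborhood /= /Gk_adj /= xpair_eqE !eqxx /=.
by case/orP=> ->; rewrite ?orbT.
Qed.

Lemma Gk_near_cube k (i : 'I_k) u x :
  ((i, x) : Gk k) \in closed_neighborhood ((i, u) : Gk k) -> cube_near u x.
Proof.
rewrite in_closed_neighborhood /= /Gk_adj /Gk_link /= xpair_eqE !eqxx /=.
rewrite /cube_near /H_near.
by case/or4P=> [-> | -> | /and3P[-> -> _] | /and3P[-> -> _]]; rewrite ?orbT.
Qed.

Lemma Gk_near_other_copy k (i j : 'I_k) u x : i != j ->
    ((i, x) : Gk k) \in closed_neighborhood ((j, u) : Gk k) ->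
  x \in [:: vg; vh].
Proof.
move=> neq_ij; rewrite in_closed_neighborhood /= /Gk_adj /Gk_link /= xpair_eqE.
rewrite [j == i]eq_sym (negPf neq_ij) /= !inE.
by case/orP=> /and3P[*]; apply/orP; [left | right].
Qed.

(** Finite check. The common neighbors [p], [q] supply the overlap that [DETIC_separation] asks for.
    Membership is tested with [H_near] and non-membership with [cube_near], so the result transfers
    to every [k]. *)
Lemma H_separators x y : x != y ->
  exists u v p q, [/\ p != q,
    [&& H_near u p, H_near v p, H_near u q & H_near v q],
    H_near u x && ~~ cube_near v x & H_near v y && ~~ cube_near u y].
Proof.
move=> neq_xy.
pose sep x y u v p q := [&& p != q,
  [&& H_near u p, H_near v p, H_near u q & H_near v q],
  H_near u x && ~~ cube_near v x & H_near v y && ~~ cube_near u y].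
have /allP/(_ x (mem_H_enum x))/allP/(_ y (mem_H_enum y)) :
    all (fun x => all (fun y => (x != y) ==>
      has (fun u => has (fun v => has (fun p => has (sep x y u v p)
        H_enum) H_enum) H_enum) H_enum) H_enum) H_enum.
  by vm_compute.
rewrite neq_xy => /hasP[u _ /hasP[v _ /hasP[p _ /hasP[q _ /and4P[? ? ? ?]]]]].
by exists u, v, p, q.
Qed.

(** Avoiding [vg] and [vh] makes [p], [q] codewords that no other copy sees; this serves both
    domination and separation across copies. *)
Lemma H_near_inner u :
  exists p q, [/\ p != q, H_near u p && (p \notin [:: vg; vh])
                & H_near u q && (q \notin [:: vg; vh])].
Proof.
pose inner u p := H_near u p && (p \notin [:: vg; vh]).
suff /hasP[p _ /hasP[q _ /and3P[? ? ?]]] :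
    has (fun p => has (fun q => [&& p != q, inner u p & inner u q]) H_enum) H_enum.
  by exists p, q.
by rewrite /inner; case: u; vm_compute.
Qed.

(** Finite check for separation inside one copy; only [vg] is barred, as the code omits it. *)
Lemma H_near_diff u v : u != v ->
  exists p q, [/\ p != q, p != vg & q != vg] /\
    ([&& H_near u p, ~~ cube_near v p, H_near u q & ~~ cube_near v q] \/
     [&& H_near v p, ~~ cube_near u p, H_near v q & ~~ cube_near u q]).
Proof.
move=> neq_uv.
pose diff u v p q :=
  [&& H_near u p, ~~ cube_near v p, H_near u q & ~~ cube_near v q].
have /allP/(_ u (mem_H_enum u))/allP/(_ v (mem_H_enum v)) :
    all (fun u => all (fun v => (u != v) ==>
      has (fun p => has (fun q =>
        [&& p != q, p != vg, q != vg & diff u v p q || diff v u p q])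
        H_enum) H_enum) H_enum) H_enum.
  by vm_compute.
rewrite neq_uv => /hasP[p _ /hasP[q _ /and4P[? ? ? /orP duv]]].
by exists p, q.
Qed.

Lemma DETIC_copy_omission k (S : {set Gk k}) (i : 'I_k) x y :
    is_DETIC S -> ((i, x) : Gk k) \notin S -> ((i, y) : Gk k) \notin S ->
  x = y.
Proof.
move=> detS xS yS; apply/eqP/negPn/negP => neq_xy.
have [u [v [p [q [neq_pq /and4P[up vp uq vq]]]]]] := H_separators neq_xy.
case/andP=> ux vx /andP[vy uy].
suff : (((i, x) : Gk k) \in S) || (((i, y) : Gk k) \in S).
  by rewrite (negPf xS) (negPf yS).
apply: (@DETIC_separation (Gk k) S (i, u) (i, v)) (@Gk_cubic k) detS _ _ _.
- apply: (card_set_ge2 (x := (i, p)) (y := (i, q))).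
  + by rewrite xpair_eqE eqxx.
  + by rewrite in_setI !H_near_Gk.
  + by rewrite in_setI !H_near_Gk.
- by apply/setDP; split; [exact: H_near_Gk | apply: contra vx => /Gk_near_cube].
- by apply/setDP; split; [exact: H_near_Gk | apply: contra uy => /Gk_near_cube].
Qed.

Lemma card_DETIC_Gk k (S : {set Gk k}) : is_DETIC S -> 7 * k <= #|S|.
Proof.
move=> detS; have := cardsC S; rewrite card_Gk => cardS.
have : #|~: S| <= k.
  (* The projection to the copy index is injective on the omitted vertices, as each copy misses at
     most one. *)
  rewrite -[leqRHS]card_ord -(card_in_imset (f := fst)) ?max_card //.
  case=> [i x] [j y] /=; rewrite !inE => xS yS eq_ij.
  by rewrite eq_ij in xS *; rewrite (DETIC_copy_omission detS xS yS).
by rewrite -(leq_add2l #|S|) cardS mulSn addnC leq_add2r.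
Qed.

Definition Gk_code k : {set Gk k} := setX setT [set~ vg].

Lemma in_Gk_code k (i : 'I_k) x : ((i, x) \in Gk_code k) = (x != vg).
Proof. by rewrite !inE. Qed.

Lemma card_Gk_code k : #|Gk_code k| = 7 * k.
Proof. by rewrite cardsX cardsT card_ord cardsC1 card_Hvertex mulnC. Qed.

Lemma Gk_code_DETIC k : is_DETIC (Gk_code k).
Proof.
have not_gh x : x \notin [:: vg; vh] -> x != vg.
  by rewrite !inE; case/norP.
(* Two codewords near [u] and unseen from [v] suffice; [i] and [j] are arbitrary, so this covers
   equal and distinct copies. *)
have diff2 (i j : 'I_k) u v p q : p != q -> p != vg -> q != vg ->
    H_near u p -> H_near u q ->
    ((i, p) : Gk k) \notin closed_neighborhood ((j, v) : Gk k) ->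
    ((i, q) : Gk k) \notin closed_neighborhood ((j, v) : Gk k) ->
    2 <= #|closed_neighborhood_in (Gk_code k) (i, u)
           :\: closed_neighborhood_in (Gk_code k) (j, v)|.
  move=> neq_pq pg qg up uq vp vq.
  apply: (card_set_ge2 (x := (i, p)) (y := (i, q))).
  - by rewrite xpair_eqE eqxx.
  - by rewrite in_setD !in_setI in_Gk_code (negPf vp) pg H_near_Gk.
  - by rewrite in_setD !in_setI in_Gk_code (negPf vq) qg H_near_Gk.
split=> [[i u] | [i u] [j v] neq_uv].
  have [p [q [neq_pq /andP[up /not_gh pg] /andP[uq /not_gh qg]]]] :=
    H_near_inner u.
  apply: (card_set_ge2 (x := (i, p)) (y := (i, q))).
  - by rewrite xpair_eqE eqxx.
  - by rewrite in_setI in_Gk_code pg H_near_Gk.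
  - by rewrite in_setI in_Gk_code qg H_near_Gk.
have [eq_ij | neq_ij] := eqVneq i j.
  rewrite -{j}eq_ij in neq_uv *.
  have {}neq_uv : u != v by apply/eqP => eq_uv; rewrite eq_uv in neq_uv.
  have [p [q [[neq_pq pg qg] [] /and4P[up vp uq vq]]]] := H_near_diff neq_uv.
    by left; apply: diff2 neq_pq pg qg up uq _ _;
       [apply: contra vp | apply: contra vq] => /Gk_near_cube.
  by right; apply: diff2 neq_pq pg qg up uq _ _;
     [apply: contra vp | apply: contra vq] => /Gk_near_cube.
left; have [p [q [neq_pq /andP[up pgh] /andP[uq qgh]]]] := H_near_inner u.
by apply: diff2 neq_pq (not_gh _ pgh) (not_gh _ qgh) up uq _ _;
   [apply: contra pgh | apply: contra qgh]; apply: Gk_near_other_copy.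
Qed.

Theorem theorem4p2 (k : nat) (hk : 1 <= k) :
  DETIC_pct (Gk k) (7%:R / 8%:R)%R.
Proof.
have cardG_gt0 : (0 < #|Gk k|%:R :> rat)%R by rewrite card_Gk ltr0n muln_gt0.
(* Over the common denominator, both halves of the minimum reduce to comparing [7 * k] with the size
   of a code. *)
have pctE : (7%:R / 8%:R = (7 * k)%:R / #|Gk k|%:R :> rat)%R.
  have k_neq0 : (k%:R != 0 :> rat)%R by rewrite pnatr_eq0 -lt0n.
  by rewrite card_Gk !natrM -mulf_div divff // mulr1.
split=> [| S detS]; rewrite pctE /density.
  by exists (Gk_code k); [exact: Gk_code_DETIC | rewrite card_Gk_code].
by rewrite ler_pM2r ?invr_gt0 // ler_nat card_DETIC_Gk.
Qed.
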